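(* Let $m$ be the standard Minkowski metric on $\mathbb R^{1+d}$, let $(N,h)$ be a Riemannian manifold, and let $\varphi:(\mathbb R^{1+d},m)\to (N,h)$ be a totally geodesic map with $\mathrm{rank}(\varphi_* )=1$. Then $\varphi$ factors as $$\varphi:\ \mathbb R^{1+d}\xrightarrow{\ \varphi_S\ }\mathbb R\xrightarrow{\ \varphi_I\ }N,$$ with $\varphi_S$ a totally geodesic submersion and $\varphi_I$ a totally geodesic immersion.
   Context: Maps are $C^\infty$. A map $\phi$ between pseudo-Riemannian manifolds is totally geodesic if $\phi\circ\gamma$ is an (affinely parametrized, possibly constant) geodesic of the target whenever $\gamma$ is a geodesic of the source; equivalently, $\phi$ is affine, i.e. $\bar\nabla_{\phi_*v}\phi_*w=\phi_*(\nabla_v w)$ for the Levi-Civita connections. The rank of $\varphi_*$ is the dimension of the image of the tangent map; it is constant for a totally geodesic map. $\mathbb R$ carries its standard metric. *)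

(* Defs.v *)
From HB Require Import structures.
From mathcomp Require Import all_boot all_order all_algebra.
From mathcomp Require Import all_classical all_reals all_analysis.

Set Implicit Arguments.
Unset Strict Implicit.
Unset Printing Implicit Defensive.

Import Order.TTheory GRing.Theory Num.Theory.
Import numFieldNormedType.Exports.

Local Open Scope ring_scope.
Local Open Scope classical_set_scope.

(* To be used with U open and V finite-dimensional: there f is of class
   C^(k+1) iff it is differentiable and all x |-> ('d f x) v are C^k. *)
Fixpoint Ck_on {R : realType} {V W : normedModType R} (k : nat) (U : set V)
    (f : V -> W) : Prop :=
  match k with
  | 0 => forall x, U x -> {for x, continuous f}
  | k'.+1 => (forall x, U x -> differentiable f x) /\
             (forall v, Ck_on k' U ('D_v f))
  end.

Definition smooth_on {R : realType} {V W : normedModType R} (U : set V)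
  (f : V -> W) : Prop := forall k, Ck_on k U f.

(* chart_map and chart_inv are total functions, only meaningful on chart_dom
   and chart_img respectively. *)
Record chart (R : realType) (n : nat) (T : topologicalType) := Chart {
  chart_dom : set T;
  chart_map : T -> 'rV[R]_n;
  chart_inv : 'rV[R]_n -> T;
  open_chart_dom : open chart_dom;
  open_chart_img : open (chart_map @` chart_dom);
  chart_mapK : forall p, chart_dom p -> chart_inv (chart_map p) = p;
  chart_map_cont : forall p, chart_dom p -> {for p, continuous chart_map};
  chart_inv_cont : forall u, (chart_map @` chart_dom) u ->
    {for u, continuous chart_inv} }.

Definition chart_img (R : realType) (n : nat) (T : topologicalType)
  (c : chart R n T) : set 'rV[R]_n := chart_map c @` chart_dom c.

Record manifold (R : realType) (n : nat) := Manifold {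
  carrier :> topologicalType;
  carrier_hausdorff : hausdorff_space carrier;
  carrier_second_countable : @second_countable carrier;
  chart_index : Type;
  charts : chart_index -> chart R n carrier;
  charts_cover : forall p : carrier, exists i, chart_dom (charts i) p;
  charts_smooth : forall i j,
    smooth_on (chart_map (charts i) @`
                 (chart_dom (charts i) `&` chart_dom (charts j)))
              (chart_map (charts j) \o chart_inv (charts i)) }.

(* The metric is given by its component matrices g_i = (g_{ab}) in each chart.
   Vectors are rows, so a tangent vector with components v in the chart i has
   components v *m J in the chart j, J the Jacobian of the transition map. *)
Record pseudo_riemannian (R : realType) (n : nat) := PseudoRiemannian {
  underlying_manifold :> manifold R n;
  metric : chart_index underlying_manifold -> 'rV[R]_n -> 'M[R]_n;
  metric_smooth : forall i,
    smooth_on (chart_img (charts i)) (metric i);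
  metric_sym : forall i u, chart_img (charts i) u ->
    (metric i u)^T = metric i u;
  metric_nondegenerate : forall i u, chart_img (charts i) u ->
    metric i u \in unitmx;
  metric_change : forall i j (p : underlying_manifold),
    chart_dom (charts i) p -> chart_dom (charts j) p ->
    let u := chart_map (charts i) p in
    let J := jacobian (chart_map (charts j) \o chart_inv (charts i)) u in
    metric i u = J *m metric j (chart_map (charts j) p) *m J^T }.

Definition riemannian (R : realType) (n : nat)
    (M : pseudo_riemannian R n) : Prop :=
  forall (i : chart_index M) u, chart_img (charts i) u ->
  forall v : 'rV[R]_n, v != 0 -> 0 < (v *m metric i u *m v^T) 0 0.

(* Gamma^k_{ab} of the Levi-Civita connection in the chart i. *)
Definition christoffel (R : realType) (n : nat) (M : pseudo_riemannian R n)
    (i : chart_index M) (u : 'rV[R]_n) (k a b : 'I_n) : R :=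
  let partial (c p q : 'I_n) : R :=
    'D_(delta_mx 0 c : 'rV[R]_n) (fun w => metric i w p q : R) u in
  2^-1 * \sum_(l < n) invmx (metric i u) k l *
           (partial a b l + partial b a l - partial l a b).

Definition smooth_curve (R : realType) (n : nat) (M : manifold R n)
    (I : set R) (gamma : R -> M) : Prop :=
  (forall t, I t -> {for t, continuous gamma}) /\
  (forall i : chart_index M,
     smooth_on (I `&` gamma @^-1` chart_dom (charts i))
               (chart_map (charts i) \o gamma)).

(* Components, in the chart i, of the covariant derivative of the velocity of
   gamma along gamma. *)
Definition acceleration (R : realType) (n : nat) (M : pseudo_riemannian R n)
    (i : chart_index M) (gamma : R -> M) (t : R) : 'rV[R]_n :=
  let x : R -> 'rV[R]_n := chart_map (charts i) \o gamma in
  let x' : R -> 'rV[R]_n := x^`() in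
  let x'' : R -> 'rV[R]_n := x^`(2) in
  \row_k (x'' t 0 k +
    \sum_(a < n) \sum_(b < n)
      christoffel i (x t) k a b * x' t 0 a * x' t 0 b).

Definition geodesic (R : realType) (n : nat) (M : pseudo_riemannian R n)
    (I : set R) (gamma : R -> M) : Prop :=
  [/\ open I, is_interval I, smooth_curve I gamma &
      forall t, I t -> forall i : chart_index M,
        chart_dom (charts i) (gamma t) -> acceleration i gamma t = 0].

Definition local_rep (R : realType) (m n : nat) (M : manifold R m)
    (N : manifold R n) (phi : M -> N) (i : chart_index M) (j : chart_index N) :
    'rV[R]_m -> 'rV[R]_n :=
  chart_map (charts j) \o phi \o chart_inv (charts i).

Definition smooth_map (R : realType) (m n : nat) (M : manifold R m)
    (N : manifold R n) (phi : M -> N) : Prop :=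
  continuous phi /\
  (forall (i : chart_index M) (j : chart_index N),
     smooth_on (chart_map (charts i) @`
                  (chart_dom (charts i) `&` phi @^-1` chart_dom (charts j)))
               (local_rep phi i j)).

Definition totally_geodesic (R : realType) (m n : nat)
    (M : pseudo_riemannian R m) (N : pseudo_riemannian R n)
    (phi : M -> N) : Prop :=
  smooth_map phi /\
  (forall (I : set R) (gamma : R -> M),
     geodesic I gamma -> geodesic I (phi \o gamma)).

(* The rank at p of the tangent map is r; by the chain rule, it does not depend
   on the charts. *)
Definition tangent_rank (R : realType) (m n : nat) (M : manifold R m)
    (N : manifold R n) (phi : M -> N) (p : M) (r : nat) : Prop :=
  forall (i : chart_index M) (j : chart_index N),
    chart_dom (charts i) p -> chart_dom (charts j) (phi p) ->
    \rank (jacobian (local_rep phi i j) (chart_map (charts i) p)) = r.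

Definition submersion (R : realType) (m n : nat) (M : manifold R m)
    (N : manifold R n) (phi : M -> N) : Prop :=
  smooth_map phi /\ forall p, tangent_rank phi p n.

Definition immersion (R : realType) (m n : nat) (M : manifold R m)
    (N : manifold R n) (phi : M -> N) : Prop :=
  smooth_map phi /\ forall p, tangent_rank phi p m.

Section Separable.
Context {R : realType} (V : normedModType R).

Lemma dense_second_countable (Q : countType) (s : Q -> V) :
  (forall x e, 0 < e -> exists q, ball x e (s q)) -> @second_countable V.
Proof.
move=> sD; pose f (qk : Q * nat) : set V := ball (s qk.1) (qk.2.+1%:R^-1 : R).
exists (range f).
  by apply: sub_countable (countableP [set: Q * nat]); exact: card_image_le.
split=> [_ [qk _ <-]|x A /nbhs_ballP[e /= e0 xeA]].
  exact: ball_open.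
have [k ke] := @ltr_add_invr R 0 (e / 2) (divr_gt0 e0 (ltr0n _ 2)).
rewrite add0r in ke.
have k0 : 0 < (k.+1%:R^-1 : R) by rewrite invr_gt0 ltr0n.
have [q xq] := sD x _ k0.
exists (f (q, k)); first by split; [exists (q, k)|exact: ball_sym].
apply: subset_trans xeA => z qz; rewrite (splitr e).
apply: (@ball_triangle _ _ (s q)); first exact: le_ball (ltW ke) _ xq.
exact: le_ball (ltW ke) _ qz.
Qed.

End Separable.

Lemma ball_ratr (R : realType) (x e : R) : 0 < e ->
  exists q : rat, ball x e (ratr q).
Proof.
move=> e0; have [|q] := @rat_in_itvoo R (x - e) (x + e).
  by rewrite ltrBlDr -addrA ltrDl addr_gt0.
by rewrite in_itv/= => q_; exists q; rewrite /ball/= ltr_distlC.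
Qed.

Lemma real_second_countable (R : realType) : @second_countable R.
Proof. exact: (@dense_second_countable R R _ ratr (@ball_ratr R)). Qed.

Lemma rV_second_countable (R : realType) (n : nat) :
  @second_countable 'rV[R]_n.
Proof.
apply: (@dense_second_countable R _ 'rV[rat]_n (map_mx ratr)) => x e e0.
have /choice[q qP] := fun j => ball_ratr (x 0 j) e0.
exists (\row_j q j); split=> // i j; rewrite !mxE ord1; exact: qP.
Qed.

Lemma smooth_on_cst (R : realType) (V W : normedModType R) (U : set V) (w : W) :
  smooth_on U (fun=> w).
Proof.
move=> k; elim: k w => [|k IHk] w /=.
  by move=> x _; exact: cst_continuous.
split=> [x _|v]; first exact: differentiable_cst.
have -> : 'D_v (fun=> w) = (fun=> 0) :> (V -> W).
  by apply/funext => x; rewrite derive_cst.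
exact: IHk.
Qed.

Lemma smooth_on_id (R : realType) (V : normedModType R) (U : set V) :
  smooth_on U (id : V -> V).
Proof.
case=> [|k] /=; first by move=> x _.
split=> [x _|v]; first by [].
have -> : 'D_v id = (fun=> v) :> (V -> V).
  by apply/funext => x; rewrite derive_id.
exact: smooth_on_cst.
Qed.

Lemma jacobian_id (R : realType) (n : nat) (u : 'rV[R]_n) :
  jacobian id u = 1%:M.
Proof.
apply/row_matrixP => i; rewrite rowE -deriveEjacobian//.
by rewrite derive_id row1.
Qed.

Section GlobalChart.
Context {R : realType} (n : nat) (T : topologicalType).
Variables (f : T -> 'rV[R]_n) (g : 'rV[R]_n -> T).
Hypotheses (fK : cancel f g) (gK : cancel g f).
Hypotheses (fC : continuous f) (gC : continuous g).
Hypotheses (TH : hausdorff_space T) (T2 : @second_countable T).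
Variables (G : 'M[R]_n) (Gsym : G^T = G) (Gunit : G \in unitmx).

Lemma global_open_img : open (f @` setT).
Proof.
suff -> : f @` setT = setT by exact: openT.
by apply/seteqP; split=> // u _; exists (g u).
Qed.

Definition global_chart : chart R n T :=
  Chart openT global_open_img (fun p _ => fK p) (fun p _ => @fC p)
    (fun u _ => @gC u).

Lemma global_transitionE : f \o g = id.
Proof. by apply/funext => u /=; rewrite gK. Qed.

Lemma global_smooth (i j : unit) :
  smooth_on (f @` (setT `&` setT)) (f \o g).
Proof. by rewrite global_transitionE; exact: smooth_on_id. Qed.

Definition global_manifold : manifold R n :=
  @Manifold R n T TH T2 unit (fun=> global_chart)
    (fun=> ex_intro _ tt I) global_smooth.

Lemma global_metric_change (i j : unit) (p : T) (_ _ : setT p) :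
  G = jacobian (f \o g) (f p) *m G *m (jacobian (f \o g) (f p))^T.
Proof. by rewrite global_transitionE jacobian_id mul1mx trmx1 mulmx1. Qed.

(* The space T with global coordinates f and the constant metric G. *)
Definition flat_space : pseudo_riemannian R n :=
  @PseudoRiemannian R n global_manifold (fun _ _ => G)
    (fun=> @smooth_on_cst _ _ _ _ G) (fun _ _ _ => Gsym) (fun _ _ _ => Gunit)
    global_metric_change.

End GlobalChart.

Definition minkowski_metric (R : realType) (d : nat) : 'M[R]_(1 + d) :=
  block_mx (-1)%:M 0 0 1%:M.

Lemma minkowski_metric_sym (R : realType) (d : nat) :
  (minkowski_metric R d)^T = minkowski_metric R d.
Proof. by rewrite /minkowski_metric tr_block_mx !tr_scalar_mx !trmx0. Qed.

Lemma minkowski_metric_unit (R : realType) (d : nat) :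
  minkowski_metric R d \in unitmx.
Proof.
by rewrite unitmxE /minkowski_metric det_ublock !det_scalar expr1n mulr1
  expr1 unitrN1.
Qed.

Definition minkowski_space (R : realType) (d : nat) :
    pseudo_riemannian R (1 + d) :=
  @flat_space R (1 + d) 'rV[R]_(1 + d) id id (fun=> erefl) (fun=> erefl)
    (fun=> cvg_id) (fun=> cvg_id) (@norm_hausdorff _ _)
    (@rV_second_countable R (1 + d)) (minkowski_metric R d)
    (minkowski_metric_sym R d) (minkowski_metric_unit R d).

Section RealLine.
Context {R : realType}.

Definition to_row (x : R) : 'rV[R]_1 := const_mx x.
Definition of_row (u : 'rV[R]_1) : R := u 0 0.

Lemma to_rowK : cancel to_row of_row.
Proof. by move=> x; rewrite /of_row mxE. Qed.

Lemma of_rowK : cancel of_row to_row.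
Proof. by move=> u; apply/rowP => j; rewrite mxE ord1. Qed.

Lemma to_row_cont : continuous to_row.
Proof.
move=> x; apply/cvg_ballP => e e0.
apply: filterS (nbhsx_ballx x e e0) => y xy; split=> // i j.
by rewrite !mxE.
Qed.

Lemma of_row_cont : continuous of_row.
Proof. exact: coord_continuous. Qed.

End RealLine.

Definition real_line (R : realType) : pseudo_riemannian R 1 :=
  flat_space (@to_rowK R) (@of_rowK R) (@to_row_cont R)
    (@of_row_cont R) (@norm_hausdorff _ _) (@real_second_countable R)
    (@trmx1 R 1) (unitmx1 R 1).

(* Main.v *)
Require Import Defs.
From mathcomp Require Import all_boot all_order all_algebra.
From mathcomp Require Import all_classical all_reals all_analysis.
From mathcomp Require Import ring.

(* Let K_p be the kernel of the differential of phi at p, a hyperplane. If v is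
   in K_p, then t |-> phi (p + t v) is a geodesic of N with zero initial
   velocity; as N is Riemannian, conservation of energy forces it to be
   constant. Hence K_p consists of the directions of the lines through p along
   which phi is constant, phi is constant on the hyperplane p + K_p, and
   therefore K_q = K_p for all q in p + K_p. So two hyperplanes p + K_p and
   q + K_q that meet are equal, and K_p does not depend on p. Take for phiS a
   linear form with kernel K_0 and for phiI the curve s |-> phi (s e), where
   phiS e = 1. *)

Set Implicit Arguments.
Unset Strict Implicit.
Unset Printing Implicit Defensive.

Import Order.TTheory GRing.Theory Num.Theory.
Import numFieldNormedType.Exports.

Local Open Scope ring_scope.
Local Open Scope classical_set_scope.

(** * Locality of [Ck_on] and its stability under composition with affine maps *)

Section SmoothOn.
Context {R : realType}.
Implicit Types V W : normedModType R.

(** The first-order expansion of [f] at [x] is also one of [g], with the same linear part;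
    [diff_unique] identifies that part with the differential of [g]. *)
Lemma near_eq_differentiable V W (f g : V -> W) (x : V) :
  {near x, f =1 g} -> differentiable f x -> differentiable g x.
Proof.
move=> fg /diff_locallyP[dfC fE].
have gE : g \o shift x = cst (g x) + 'd f x +o_ 0 id.
  apply/eqaddoP => e e0; have /eqaddoP/(_ e e0) fe := fE.
  have fg0 : \forall h \near 0, f (h + x) = g (h + x).
    by move: fg; rewrite (near_shift 0) subr0.
  near=> h; rewrite [X in `|X|](_ : _ = (f \o shift x - (cst (f x) + 'd f x)) h).
    by near: h; exact: fe.
  rewrite !fctE /= (nbhs_singleton fg); congr (_ - _).
  by apply/esym; near: h; exact: fg0.
by apply/diff_locallyP; rewrite (diff_unique dfC gE).
Unshelve. all: by end_near. Qed.

(** As [U] is open, equality on [U] is equality near each of its points, so directional derivatives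
    agree on [U] too and the induction proceeds. *)
Lemma Ck_on_ext V W k (U : set V) (f g : V -> W) :
  open U -> (forall x, U x -> f x = g x) -> Ck_on k U f -> Ck_on k U g.
Proof.
move=> Uo; elim: k f g => [|k IHk] f g fg /=;
  have nfg x : U x -> {near x, f =1 g}
  by move=> Ux; apply: filterS fg _; exact: open_nbhs_nbhs.
  move=> fC x Ux; rewrite /prop_for /continuous_at -(fg _ Ux).
  exact: cvg_trans (near_eq_cvg (nfg x Ux)) (fC x Ux).
move=> [fD fC]; split=> [x Ux|v].
  exact: near_eq_differentiable (nfg x Ux) (fD x Ux).
by apply: IHk (fC v) => x Ux; apply: near_eq_derive; exact: nfg.
Qed.

Lemma derive_comp_linear V W (f : V -> W) (W' : normedModType R)
    (L : {linear W -> W'}) b x v :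
  continuous L -> differentiable f x ->
  'D_v (fun y => L (f y) + b) x = L ('D_v f x).
Proof.
move=> LC fx; have Lx := linear_differentiable (f x) LC.
have Lfx : differentiable (L \o f) x by exact: differentiable_comp.
rewrite (_ : (fun _ => _) = (L \o f) + cst b)//.
rewrite deriveD ?derive_cst ?addr0; [|exact: diff_derivable..].
by rewrite !deriveE// diff_comp//= diff_lin.
Qed.

Lemma Ck_on_linear_comp V W (W' : normedModType R) (L : {linear W -> W'}) b k
    (U : set V) (f : V -> W) :
  continuous L -> open U -> Ck_on k U f -> Ck_on k U (fun x => L (f x) + b).
Proof.
move=> LC Uo; elim: k f b => [|k IHk] f b /=.
  move=> fC x Ux; apply: cvgD; last exact: cvg_cst.
  by apply: continuous_comp; [exact: fC|exact: LC].
move=> [fD fC]; split=> [x Ux|v].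
  have -> : (fun y => L (f y) + b) = (L \o f) + cst b by [].
  apply: differentiableD; last exact: differentiable_cst.
  by apply: differentiable_comp; [exact: fD|exact: linear_differentiable].
(* The derivative has lost the constant [b]; the induction hypothesis, general in [b], is used with
   0. *)
apply: (@Ck_on_ext _ _ _ _ (fun x => L ('D_v f x) + 0)) => //; last exact: IHk.
by move=> x Ux; rewrite addr0 derive_comp_linear//; exact: fD.
Qed.

(** By linearity of [L], the two difference quotients coincide. *)
Lemma derive_linear_shift V (V' : normedModType R) W (L : {linear V' -> V}) b
    (f : V -> W) v :
  'D_v (fun x => f (L x + b)) = (fun x => 'D_(L v) f (L x + b)).
Proof.
apply/funext => x; rewrite /derive.
by under eq_fun do rewrite /= (linearD L) (linearZ_LR L) -addrA.
Qed.

Lemma Ck_on_comp_linear V (V' : normedModType R) W (L : {linear V' -> V}) b k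
    (U : set V) (U' : set V') (f : V -> W) :
  continuous L -> (forall x, U' x -> U (L x + b)) -> Ck_on k U f ->
  Ck_on k U' (fun x => f (L x + b)).
Proof.
move=> LC UU'; have aC : continuous (fun x => L x + b).
  by move=> x; apply: cvgD; [exact: LC|exact: cvg_cst].
elim: k f => [|k IHk] f /=.
  move=> fC x U'x; apply: (@continuous_comp _ _ _ (fun x => L x + b) f).
    exact: aC.
  exact/fC/UU'.
move=> [fD fC]; split=> [x U'x|v].
  have -> : (fun x => f (L x + b)) = f \o (L \+ cst b) by [].
  apply: differentiable_comp; last exact/fD/UU'.
  by apply: differentiableD => //; exact: linear_differentiable.
by rewrite derive_linear_shift; exact: (IHk ('D_(L v) f)) (fC _).
Qed.

End SmoothOn.

(** * Linear maps given by matrices *)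

Section LinearImages.
Context {R : realType}.

Lemma mulmxr_continuous m n (A : 'M[R]_(m, n)) :
  continuous (mulmxr A : 'rV[R]_m -> 'rV[R]_n).
Proof.
have -> : mulmxr A = \sum_(i < m) (fun u : 'rV[R]_m => u 0 i *: row i A).
  by apply/funext => u; rewrite fct_sumE /= mulmx_sum_row.
move=> u; apply: differentiable_continuous; apply: differentiable_sum => i.
exact/differentiableZl/differentiable_coord.
Qed.

Lemma jacobian_mulmxr m n (A : 'M[R]_(m, n)) u : jacobian (mulmxr A) u = A.
Proof.
have LC := @mulmxr_continuous _ _ A.
apply/row_matrixP => i; rewrite !rowE -deriveEjacobian;
  last exact: linear_differentiable.
by rewrite deriveE ?diff_lin//; exact: linear_differentiable.
Qed.

Lemma acceleration_linear_comp m n (A : 'M[R]_(m, n)) b (I : set R)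
    (x : R -> 'rV[R]_m) t : open I -> smooth_on I x -> I t ->
  derive1n 2 (fun s => x s *m A + b) t = derive1n 2 x t *m A.
Proof.
move=> Io xS It; have LC := @mulmxr_continuous _ _ A.
have [xD /(_ 1) [x'D _]] := xS 2.
rewrite !derive1nS !derive1n0 !derive1E.
have D1 s : I s -> (fun s => x s *m A + b)^`() s = mulmxr A ('D_1 x s) + 0.
  move=> Is; rewrite derive1E addr0.
  exact: (@derive_comp_linear _ _ _ x _ (mulmxr A) b s 1 LC (xD s Is)).
rewrite (@near_eq_derive _ _ _ _ (fun s => mulmxr A ('D_1 x s) + 0)); last first.
  by apply: filterS D1 _; exact: open_nbhs_nbhs.
rewrite (@derive_comp_linear _ _ _ ('D_1 x) _ (mulmxr A) 0 t 1 LC (x'D t It)) /=.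
by rewrite (_ : derive1 x = 'D_1 x)//; apply/funext => s; rewrite derive1E.
Qed.

End LinearImages.

(** * Geodesics and affine maps of flat spaces *)

Section FlatAcceleration.
Context {R : realType} (m : nat) (T : topologicalType).
Context (f : T -> 'rV[R]_m) (g : 'rV[R]_m -> T).
Hypotheses (fK : cancel f g) (gK : cancel g f).
Hypotheses (fC : continuous f) (gC : continuous g).
Hypotheses (TH : hausdorff_space T) (T2 : @second_countable T).
Context (G : 'M[R]_m) (Gsym : G^T = G) (Gunit : G \in unitmx).
Let M := flat_space fK gK fC gC TH T2 Gsym Gunit.

(** The metric is constant in the global chart, so every Christoffel symbol vanishes. *)
Lemma flat_acceleration i (gamma : R -> M) t :
  acceleration i gamma t = (f \o gamma)^`(2) t.
Proof.
apply/rowP => k; rewrite mxE.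
rewrite big1 ?addr0// => a _; rewrite big1// => b _.
rewrite /christoffel big1 ?mulr0 ?mul0r// => l _.
by rewrite /= !derive_cst !addr0 subr0 mulr0.
Qed.

End FlatAcceleration.

Section AffineMaps.
Context {R : realType}.
Context (m n : nat) (T T' : topologicalType).
Context (f : T -> 'rV[R]_m) (g : 'rV[R]_m -> T).
Context (f' : T' -> 'rV[R]_n) (g' : 'rV[R]_n -> T').
Hypotheses (fK : cancel f g) (gK : cancel g f).
Hypotheses (fC : continuous f) (gC : continuous g).
Hypotheses (TH : hausdorff_space T) (T2 : @second_countable T).
Context (G : 'M[R]_m) (Gsym : G^T = G) (Gunit : G \in unitmx).
Hypotheses (fK' : cancel f' g') (gK' : cancel g' f').
Hypotheses (fC' : continuous f') (gC' : continuous g').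
Hypotheses (TH' : hausdorff_space T') (T2' : @second_countable T').
Context (G' : 'M[R]_n) (Gsym' : G'^T = G') (Gunit' : G' \in unitmx).
Let M := flat_space fK gK fC gC TH T2 Gsym Gunit.
Let M' := flat_space fK' gK' fC' gC' TH' T2' Gsym' Gunit'.

(** In global coordinates the geodesics of a flat space have zero second derivative, and an affine
    map multiplies that derivative by [A]. The criterion serves for [phiS], for the lines of
    Minkowski space and for the inclusion of the line spanned by [e]. *)
Lemma affine_totally_geodesic (A : 'M[R]_(m, n)) b (psi : M -> M') :
  (forall p, f' (psi p) = f p *m A + b) -> totally_geodesic psi.
Proof.
move=> psiE; have LC := @mulmxr_continuous _ _ _ A.
have psiC : continuous psi.
  have -> : psi = fun p => g' (f p *m A + b).
    by apply/funext => p; rewrite -psiE fK'.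
  move=> p; apply: (@continuous_comp _ _ _ (fun p => f p *m A + b) g').
    apply: cvgD; last exact: cvg_cst.
    by apply: (@continuous_comp _ _ _ f (mulmxr A)); [exact: fC|exact: LC].
  exact: gC'.
have compE (h : R -> M) : f' \o (psi \o h) = (fun s => (f \o h) s *m A + b).
  by apply/funext => s /=; rewrite psiE.
split; first split=> // i j k.
  have -> : local_rep psi i j = (fun u => mulmxr A u + b).
    by apply/funext => u; rewrite /local_rep /= psiE gK.
  apply: (@Ck_on_comp_linear _ _ _ _ (mulmxr A) b k setT _ id) => //.
  exact: smooth_on_id.
move=> I gamma [Io Ii [gammaC gS] gA].
have gSI : smooth_on I (f \o gamma).
  by have := gS tt; rewrite preimage_setT setIT.
split=> //; first split=> [t It|i k].
- by apply: continuous_comp; [exact: gammaC|exact: psiC].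
- rewrite preimage_setT setIT /= compE.
  exact: (@Ck_on_linear_comp _ _ _ _ (mulmxr A) b k I (f \o gamma) LC Io).
move=> t It i _; rewrite flat_acceleration compE.
rewrite (acceleration_linear_comp A b Io gSI It).
have := gA t It tt Logic.I; rewrite flat_acceleration => ->; exact: mul0mx.
Qed.

End AffineMaps.

(** * Conservation of energy along geodesics *)

Section Energy.
Context {R : realType}.

(** Compatibility of the Levi-Civita connection with the metric, as pointwise algebra: [v] stands
    for the velocity, [w] for the second derivative of the coordinates, [P c a b] for the partial
    derivative of [g a b] along coordinate [c]. The geodesic equation then kills the time derivative
    of g(v, v). *)
Lemma geodesic_power_eq0 n (g : 'M[R]_n) (P : 'I_n -> 'I_n -> 'I_n -> R)
    (v w : 'rV[R]_n) :
  g^T = g -> g \in unitmx ->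
  (forall k, w 0 k + \sum_(a < n) \sum_(b < n)
     (2^-1 * \sum_(l < n) invmx g k l * (P a b l + P b a l - P l a b)) *
     v 0 a * v 0 b = 0) ->
  \sum_(a < n) \sum_(b < n)
     (w 0 a * g a b * v 0 b + v 0 a * (\sum_(c < n) v 0 c * P c a b) * v 0 b +
      v 0 a * g a b * w 0 b) = 0.
Proof.
move=> gsym gunit wE.
(* Twice the Christoffel symbols of the first kind, contracted twice with [v]. *)
pose q : 'rV[R]_n := \row_l \sum_(a < n) \sum_(b < n)
  (P a b l + P b a l - P l a b) * v 0 a * v 0 b.
have wq : w = - (2^-1 *: (q *m (invmx g)^T)).
  apply/rowP => k; rewrite !mxE; apply/eqP; rewrite -addr_eq0; apply/eqP.
  rewrite -[RHS](wE k); congr (_ + _); rewrite mulr_sumr.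
  under eq_bigr do rewrite !mxE mulr_suml mulr_sumr.
  rewrite exchange_big; apply: eq_bigr => a _.
  under eq_bigr do rewrite mulr_suml mulr_sumr.
  rewrite exchange_big; apply: eq_bigr => b _.
  rewrite mulr_sumr !mulr_suml; apply: eq_bigr => l _.
  ring.
have wg : w *m g = - (2^-1 *: q).
  have gi : (invmx g)^T *m g = 1%:M by rewrite -{2}gsym -trmx_mul mulmxV// trmx1.
  by rewrite wq mulNmx -scalemxAl -mulmxA gi mulmx1.
(* The full contraction of the derivative of [g] with [v]. Each of the three terms of [q] contracts
   with [v] to [T], one of them with a minus sign. *)
pose T := \sum_(a < n) \sum_(b < n) \sum_(c < n) v 0 a * v 0 b * v 0 c * P a b c.
have qv : \sum_(l < n) q 0 l * v 0 l = T.
  have T1 : \sum_(l < n) \sum_(a < n) \sum_(b < n)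
      P a b l * v 0 a * v 0 b * v 0 l = T.
    rewrite exchange_big; apply: eq_bigr => a _.
    by rewrite exchange_big; do 2 apply: eq_bigr => ? _; ring.
  have T2 : \sum_(l < n) \sum_(a < n) \sum_(b < n)
      P b a l * v 0 a * v 0 b * v 0 l = T.
    rewrite -T1; apply: eq_bigr => l _; rewrite exchange_big.
    by do 2 apply: eq_bigr => ? _; ring.
  have T3 : \sum_(l < n) \sum_(a < n) \sum_(b < n)
      P l a b * v 0 a * v 0 b * v 0 l = T.
    by do 3 apply: eq_bigr => ? _; ring.
  transitivity (T + T - T); last by rewrite addrK.
  rewrite -{1}T1 -{1}T2 -T3 -big_split -sumrB; apply: eq_bigr => l _.
  rewrite mxE mulr_suml -big_split -sumrB; apply: eq_bigr => a _.
  rewrite mulr_suml -big_split -sumrB; apply: eq_bigr => b _ /=.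
  ring.
(* The outer two terms of the goal both equal [A], which is - T / 2, and the middle one is [T]. *)
pose A := \sum_(a < n) \sum_(b < n) w 0 a * g a b * v 0 b.
have AE : A = - (2^-1 * T).
  rewrite /A exchange_big -qv mulr_sumr -sumrN; apply: eq_bigr => b _.
  rewrite mulrA -mulNr; transitivity ((w *m g) 0 b * v 0 b).
    by rewrite mxE mulr_suml.
  by rewrite wg !mxE.
have BE : \sum_(a < n) \sum_(b < n) v 0 a * g a b * w 0 b = A.
  rewrite /A exchange_big; apply: eq_bigr => b _; apply: eq_bigr => a _.
  have -> : g a b = g b a by rewrite -{1}gsym mxE.
  ring.
have CE : \sum_(a < n) \sum_(b < n)
    v 0 a * (\sum_(c < n) v 0 c * P c a b) * v 0 b = T.
  transitivity (\sum_(a < n) \sum_(b < n) \sum_(c < n)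
    v 0 a * v 0 c * P c a b * v 0 b).
    apply: eq_bigr => a _; apply: eq_bigr => b _.
    by rewrite mulr_sumr mulr_suml; apply: eq_bigr => c _; rewrite mulrA.
  under eq_bigr do rewrite exchange_big.
  rewrite exchange_big.
  by do 3 apply: eq_bigr => ? _; ring.
under eq_bigr do rewrite !big_split/=.
rewrite !big_split /= -/A BE CE AE; by field.
Qed.

Lemma is_derive_coord m n (V : normedModType R) (A : V -> 'M[R]_(m, n))
    (dA : 'M[R]_(m, n)) t v i j :
  is_derive t v A dA -> is_derive t v (fun x => A x i j) (dA i j).
Proof.
move=> [At AE]; split; first by move/derivable_mxP : At; exact.
by rewrite -AE derive_mx// mxE.
Qed.

Lemma derive_comp_curve n (F : 'rV[R]_n -> R) (x : R -> 'rV[R]_n) t :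
  differentiable F (x t) -> differentiable x t ->
  is_derive t 1 (fun s => F (x s))
    (\sum_(c < n) 'D_1 x t 0 c * 'D_(delta_mx 0 c) F (x t)).
Proof.
move=> dF dx; have dFx : differentiable (F \o x) t by exact: differentiable_comp.
split; first exact: diff_derivable dFx.
have -> : 'D_1 (fun s => F (x s)) t = 'd F (x t) ('D_1 x t).
  by rewrite (deriveE _ dFx) diff_comp//= deriveE.
rewrite {1}[X in 'd F _ X]row_sum_delta linear_sum.
by apply: eq_bigr => c _; rewrite linearZ/= (deriveE _ dF).
Qed.

(** The squared length of the velocity, without the usual factor 1/2; meaningful while [gamma] stays
    in the domain of the chart. *)
Definition energy n (M : pseudo_riemannian R n) (i : chart_index M)
    (gamma : R -> M) (t : R) : R :=
  let x := chart_map (charts i) \o gamma in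
  ('D_1 x t *m metric i (x t) *m ('D_1 x t)^T) 0 0.

(** The product and chain rules yield exactly the sum that [geodesic_power_eq0] annihilates. *)
Lemma geodesic_energy_derive n (M : pseudo_riemannian R n) (I : set R)
    (gamma : R -> M) (i : chart_index M) t :
  geodesic I gamma -> I t -> chart_dom (charts i) (gamma t) ->
  is_derive t 1 (energy i gamma) 0.
Proof.
move=> [_ _ [_ gS] gA] It it.
have [xD /(_ 1)[x'D _]] := gS i 2.
have xt := xD t (conj It it); have x't := x'D t (conj It it).
set x := chart_map (charts i) \o gamma in xt x't.
have imt : chart_img (charts i) (x t) by exists (gamma t).
have gD a b : differentiable (fun u => metric i u a b) (x t).
  have [mD _] := metric_smooth i 1.
  exact: (differentiable_comp (mD _ imt) (differentiable_coord _ a b)).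
have x'E a : is_derive t 1 (fun s => 'D_1 x s 0 a) ('D_1 ('D_1 x) t 0 a).
  exact/is_derive_coord/derivableP/diff_derivable.
have gE a b := derive_comp_curve (gD a b) xt.
have eE : energy i gamma = \sum_(a < n) \sum_(b < n)
    ((fun s => 'D_1 x s 0 a) * (fun s => metric i (x s) a b) *
     (fun s => 'D_1 x s 0 b)).
  apply/funext => s; rewrite fct_sumE /energy mxE.
  under [RHS]eq_bigr do rewrite fct_sumE.
  rewrite [RHS]exchange_big.
  by apply: eq_bigr => b _; rewrite !mxE mulr_suml.
have dE a b : is_derive t 1 ((fun s => 'D_1 x s 0 a) *
    (fun s => metric i (x s) a b) * (fun s => 'D_1 x s 0 b))
    ('D_1 ('D_1 x) t 0 a * metric i (x t) a b * 'D_1 x t 0 b +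
     'D_1 x t 0 a * (\sum_(c < n) 'D_1 x t 0 c *
       'D_(delta_mx 0 c) (fun u => metric i u a b) (x t)) * 'D_1 x t 0 b +
     'D_1 x t 0 a * metric i (x t) a b * 'D_1 ('D_1 x) t 0 b).
  (* The derivative is found by instance search from [x'E] and [gE] in the context. *)
  apply: is_derive_eq; rewrite /GRing.scale/= !fctE; ring.
rewrite eE; apply: is_derive_eq.
apply: (@geodesic_power_eq0 _ (metric i (x t)) _ ('D_1 x t) ('D_1 ('D_1 x) t)).
- exact: (Defs.metric_sym imt).
- exact: (metric_nondegenerate imt).
move=> k; have /rowP/(_ k) := gA t It i it.
rewrite !mxE derive1nS derive1n1 derive1E.
rewrite (_ : derive1 x = 'D_1 x)//; apply/funext => s; exact: derive1E.
Qed.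

End Energy.

(** * Geodesics of a Riemannian manifold that are at rest at one instant *)

Section Rest.
Context {R : realType}.

Lemma derive0_ball_cst (f : R -> R) (x e : R) :
  (forall y, ball x e y -> is_derive y 1 f 0) ->
  forall y z, ball x e y -> ball x e z -> f y = f z.
Proof.
move=> f0 y z; wlog yz : y z / y <= z => [wl|] xy xz.
  by have /orP[yz|zy] := le_total y z; [exact: wl|apply/esym/wl].
have {}f0 w : w \in `[y, z]%R -> is_derive w 1 f 0.
  rewrite in_itv/= => /andP[yw wz]; apply: f0; move: xy xz.
  rewrite /ball/= !ltr_distlC => /andP[xy _] /andP[_ xz].
  by rewrite (lt_le_trans xy yw) (le_lt_trans wz xz).
have fC : {within `[y, z], continuous f}.
  by apply: derivable_within_continuous => w /f0[].
have fD w : w \in `]y, z[%R -> is_derive w 1 f ((fun=> 0) w).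
  by move=> wyz; apply: f0; exact: subset_itv_oo_cc wyz.
have [c _] := MVT_segment yz fD fC.
by rewrite mul0r => /eqP; rewrite subr_eq0 => /eqP.
Qed.

Lemma derive0_ball_cst_rV n (f : R -> 'rV[R]_n) (x e : R) :
  (forall y, ball x e y -> is_derive y 1 f 0) ->
  forall y z, ball x e y -> ball x e z -> f y = f z.
Proof.
move=> f0 y z xy xz; apply/rowP => j.
apply: (@derive0_ball_cst (fun s => f s 0 j) x e) => // w /f0.
by move/(is_derive_coord 0 j); rewrite mxE.
Qed.

(** On a ball sent into one chart domain the energy is constant, so rest at one time [s] makes it
    zero throughout, and positivity makes the coordinates constant. The radius is fixed before [s],
    so that [s] can later be chosen near a limit point. *)
Lemma geodesic_rest_ball n (M : pseudo_riemannian R n) (gamma : R -> M)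
    (i : chart_index M) t :
  riemannian M -> geodesic setT gamma -> chart_dom (charts i) (gamma t) ->
  exists2 e, 0 < e & forall s, ball t e s ->
    'D_1 (chart_map (charts i) \o gamma) s = 0 ->
    forall r, ball t e r -> gamma r = gamma s.
Proof.
move=> Mpos geo it; have [_ _ [gC gS] _] := geo.
have : nbhs t (gamma @^-1` chart_dom (charts i)).
  by apply: (gC t I); apply: open_nbhs_nbhs; split=> //; exact: open_chart_dom.
move=> /nbhs_ballP[e /= e0 te]; exists e => // s ts Ds r tr.
set x := chart_map (charts i) \o gamma in Ds.
have E0 u : ball t e u -> energy i gamma u = 0.
  move=> tu; have : energy i gamma u = energy i gamma s.
    apply: (derive0_ball_cst _ tu ts) => w tw.
    by apply: (geodesic_energy_derive geo) => //; exact: te.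
  by move=> ->; rewrite /energy Ds mul0mx mul0mx mxE.
have D0 u : ball t e u -> is_derive u 1 x 0.
  move=> tu; have [xD _] := gS i 1.
  have -> : 0 = 'D_1 x u.
    apply/esym/eqP/negP => /negP Dx.
    have imu : chart_img (charts i) (x u) by exists (gamma u) => //; exact: te.
    by have := Mpos i (x u) imu _ Dx; rewrite -/(energy i gamma u) E0// ltxx.
  apply/derivableP/diff_derivable/xD; split => //; exact: te.
rewrite -(chart_mapK (te _ tr)) -(chart_mapK (te _ ts)).
by congr chart_inv; exact: derive0_ball_cst_rV D0 _ _ tr ts.
Qed.

Lemma geodesic_rest n (M : pseudo_riemannian R n) (gamma : R -> M)
    (i : chart_index M) t :
  riemannian M -> geodesic setT gamma -> chart_dom (charts i) (gamma t) ->
  'D_1 (chart_map (charts i) \o gamma) t = 0 ->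
  forall s, gamma s = gamma t.
Proof.
move=> Mpos geo it Dt.
(* Requiring equality near [u], not only at [u], makes [A] open and gives zero velocity at its
   points. Connectedness of the line is applied to [A]. *)
pose A := [set u : R | \forall s \near u, gamma s = gamma t].
suff AT : A = setT.
  by move=> s; have /nbhs_singleton : A s by rewrite AT.
have : connected [set: R] by exact/connected_intervalP.
apply.
- exists t; have [e e0 te] := geodesic_rest_ball Mpos geo it.
  apply/nbhs_ballP; exists e => //= s ts; apply: te => //; exact: ballxx.
- exists A; last by rewrite setTI.
  rewrite openE => u; exact: near_join.
exists A; last by rewrite setTI.
(* [A] is closed: a ball around the limit point [u] contains some [s] in [A], where [gamma] is at
   rest, so [gamma] is constant on the ball. *)
move=> u Au; have [j ju] := charts_cover (gamma u).
have [e e0 ue] := geodesic_rest_ball Mpos geo ju.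
have [s [As us]] := Au _ (nbhsx_ballx u e e0).
have Ds : 'D_1 (chart_map (charts j) \o gamma) s = 0.
  rewrite (@near_eq_derive _ _ _ _ (cst (chart_map (charts j) (gamma t))))
    ?derive_cst//.
  by apply: filterS As => r /= ->.
apply/nbhs_ballP; exists e => //= r ur.
by rewrite (ue s us Ds r ur) (nbhs_singleton As).
Qed.

End Rest.

(** In the rank factorization of [A] the left factor is a column [u] and the right one a free row,
    which can be cancelled. The kernel thus becomes that of one nonzero linear form. *)
Lemma rank1_kernel (F : fieldType) m n (A : 'M[F]_(m, n)) : \rank A = 1 ->
  exists2 u : 'cV[F]_m, u != 0 &
    forall v : 'rV_m, v *m A = 0 <-> (v *m u) 0 0 = 0.
Proof.
move=> A1; have : A != 0 by rewrite -mxrank_eq0 A1.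
move: (col_base A) (row_base A) (mulmx_base A) (row_base_free A); rewrite A1.
move=> u w <- wfree uw0; exists u => [|v].
  by apply: contraNneq uw0 => ->; rewrite mul0mx.
rewrite mulmxA; split=> [/eqP|vu0].
  by rewrite mulmx_free_eq0// => /eqP->; rewrite mxE.
by rewrite [v *m u]mx11_scalar vu0 raddf0 mul0mx.
Qed.

(** * Maps constant along hyperplanes *)

Section ParallelHyperplanes.
Context (F : fieldType) (V : lmodType F) (T : Type) (phi : V -> T).
Context (a : V -> V -> F).
Hypothesis a_scalar : forall p, scalar (a p).
Hypothesis aP : forall p v, (forall t, phi (p + t *: v) = phi p) <-> a p v = 0.

Let aD p u v : a p (u + v) = a p u + a p v.
Proof. by have := a_scalar p 1 u v; rewrite scale1r mul1r. Qed.

Let a0 p : a p 0 = 0.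
Proof. by apply: (addrI (a p 0)); rewrite -aD !addr0. Qed.

Let aZ p k v : a p (k *: v) = k * a p v.
Proof. by have := a_scalar p k v 0; rewrite a0 !addr0. Qed.

(** Both [k] and [k + t *: w] lie in the kernel of [a p], so [phi] takes the value [phi p] at
    [p + k] and at [p + k + t *: w]. *)
Let a_leaf p k w : a p k = 0 -> a p w = 0 -> a (p + k) w = 0.
Proof.
move=> pk pw; apply/aP => t.
have phip u : a p u = 0 -> phi (p + u) = phi p.
  by move=> /aP/(_ 1); rewrite scale1r.
by rewrite -addrA !phip// aD pk aZ pw mulr0 addr0.
Qed.

(* Otherwise the hyperplanes p + ker (a p) and q + ker (a q), along which the
   kernel is constant, would meet. *)
Lemma parallel_hyperplanes p q v : a p v = 0 -> a q v = 0.
Proof.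
move=> pv; apply/eqP; apply/negPn/negP => qv.
(* Chosen so that [p + t *: v] lies on the hyperplane through [q]. *)
pose t := a q (q - p) / a q v.
have aN r u : a r (- u) = - a r u by rewrite -scaleN1r aZ mulN1r.
have ptv : a p (t *: v) = 0 by rewrite aZ pv mulr0.
have qr : a q (p + t *: v - q) = 0.
  by rewrite addrAC aD aZ /t divfK// -[p - q]opprB aN addNr.
have := a_leaf qr; rewrite addrCA subrr addr0 => qK.
(* By [qK], the hyperplane through the meeting point contains [q] in turn, so [a_leaf] also leads
   back to [q]. *)
have rK w : a (p + t *: v) w = 0 -> a q w = 0.
  have := @a_leaf (p + t *: v) (q - (p + t *: v)) w.
  by rewrite addrCA subrr addr0; apply; rewrite -opprB aN qK ?oppr0.
by move/eqP: qv; apply; apply: rK; exact: a_leaf.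
Qed.

End ParallelHyperplanes.

(** * Lines as geodesics *)

Section Lines.
Context {R : realType}.

Lemma derive_line (V W : normedModType R) (f : V -> W) (p v : V) t :
  'D_1 (fun s : R => f (p + s *: v)) t = 'D_v f (p + t *: v).
Proof.
rewrite /derive; under eq_fun do rewrite /= [_ *: 1]mulr1 scalerDl addrCA.
by [].
Qed.

(** Composed with this curve, a totally geodesic map from the line is itself seen as a geodesic. *)
Lemma geodesic_real_line : geodesic setT (id : R -> real_line R).
Proof.
have toE : @to_row R = *:%R^~ (const_mx 1).
  by apply/funext => s; apply/rowP => j; rewrite !mxE mulr1.
have toD s : is_diff s (@to_row R) (@to_row R).
  by rewrite toE; exact: is_diff_scalel.
have D1 v : 'D_v (@to_row R) = fun=> to_row v.
  by apply/funext => s; rewrite deriveE// diff_val.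
split=> //.
- exact: openT.
- split=> [t _|i k]; first by [].
  case: k => [|k] /=; first by move=> s _; exact: to_row_cont.
  by split=> // v; rewrite D1; exact: smooth_on_cst.
move=> t _ i _; rewrite flat_acceleration derive1nS derive1n1 derive1E.
have -> : derive1 (@to_row R \o id) = 'D_1 (@to_row R).
  by apply/funext => s; rewrite derive1E.
by rewrite D1 derive_cst.
Qed.

Lemma geodesic_minkowski_line d (p v : 'rV[R]_(1 + d)) :
  geodesic setT ((fun t => p + t *: v) : R -> minkowski_space R d).
Proof.
have [_] : totally_geodesic
    ((fun t => p + t *: v) : real_line R -> minkowski_space R d).
  apply: (affine_totally_geodesic (A := v) (b := p)) => t /=.
  rewrite addrC; congr (_ + _); apply/rowP => j.
  by rewrite !mxE big_ord1 !mxE.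
by move=> /(_ _ _ geodesic_real_line).
Qed.

End Lines.

Lemma rank_cV (F : fieldType) n (u : 'cV[F]_n) : \rank u = (u != 0) :> nat.
Proof. by rewrite -mxrank_tr rank_rV trmx_eq0. Qed.

(** * Fibers of a totally geodesic map of rank 1 *)

Section Factorization.
Context {R : realType}.
Context (d n : nat) (N : pseudo_riemannian R n) (phi : minkowski_space R d -> N).
Hypotheses (phi_tg : totally_geodesic phi).

Lemma minkowski_rep_differentiable (j : chart_index N) p :
  chart_dom (charts j) (phi p) ->
  differentiable (chart_map (charts j) \o phi : 'rV[R]_(1 + d) -> 'rV[R]_n) p.
Proof.
move=> jp; have [[_ /(_ tt j) phiS] _] := phi_tg.
have [phiD _] := phiS 1; apply: phiD.
by exists p.
Qed.

(** The right side says that the image of the line, a geodesic of [N], has zero velocity at time 0;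
    by [geodesic_rest] it is then constant. *)
Lemma constant_on_lineP (j : chart_index N) (p v : 'rV[R]_(1 + d)) :
  riemannian N -> chart_dom (charts j) (phi p) ->
  (forall t : R, phi (p + t *: v) = phi p) <->
  v *m jacobian (chart_map (charts j) \o phi) p = 0.
Proof.
move=> Npos jp; rewrite -deriveEjacobian; last exact: minkowski_rep_differentiable.
have lineD : 'D_1 (fun s : R => (chart_map (charts j) \o phi) (p + s *: v)) 0 =
    'D_v (chart_map (charts j) \o phi : 'rV[R]_(1 + d) -> 'rV[R]_n) p.
  by rewrite derive_line scale0r addr0.
rewrite -lineD; split=> [phiK|D0 t].
  rewrite (_ : (fun s => _) = cst (chart_map (charts j) (phi p))) ?derive_cst//.
  by apply/funext => s /=; rewrite phiK.
have [_ /(_ _ _ (geodesic_minkowski_line p v)) geo] := phi_tg.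
have jp0 : chart_dom (charts j) (phi (p + 0 *: v)) by rewrite scale0r addr0.
by have /= -> := geodesic_rest Npos geo jp0 D0 t; rewrite scale0r addr0.
Qed.

(** The map is [phi] after a linear inclusion, and both send geodesics to geodesics. *)
Lemma totally_geodesic_line (e : 'rV[R]_(1 + d)) :
  totally_geodesic ((fun s => phi (s *: e)) : real_line R -> N).
Proof.
pose inc : real_line R -> minkowski_space R d := fun s => s *: e.
have incE (s : R) : s *: e = to_row s *m e.
  by apply/rowP => j; rewrite !mxE big_ord1 !mxE.
have [[incC _] inc_geo] : totally_geodesic inc.
  apply: (affine_totally_geodesic (A := e) (b := 0)) => s /=.
  by rewrite addr0 -incE.
have [[phiC phiS] phi_geo] := phi_tg.
split; last by move=> I gamma /inc_geo/phi_geo.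
split=> [s|i j k]; first by apply: continuous_comp; [exact: incC|exact: phiC].
have -> : local_rep ((fun s => phi (s *: e)) : real_line R -> N) i j =
    (fun u => local_rep phi tt j (mulmxr e u + 0)).
  by apply/funext => u; rewrite /local_rep /= addr0 incE of_rowK.
apply: (@Ck_on_comp_linear _ _ _ _ (mulmxr e) 0 k _ _ _ _ _
  (phiS tt j k)).
  exact: mulmxr_continuous.
move=> _ [s [_ js] <-] /=; exists (s *: e); last by rewrite addr0 incE.
by split.
Qed.

Hypothesis N_pos : riemannian N.
Hypothesis phi_rank : forall p : minkowski_space R d, tangent_rank phi p 1.

Lemma constant_on_hyperplane (p : 'rV[R]_(1 + d)) :
  exists2 u : 'cV[R]_(1 + d), u != 0 &
  forall v, (forall t : R, phi (p + t *: v) = phi p) <-> (v *m u) 0 0 = 0.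
Proof.
have [j jp] := charts_cover (phi p).
have [u u0 uP] := rank1_kernel (phi_rank (i := tt) Logic.I jp).
by exists u => // v; apply: iff_trans (uP v); exact: constant_on_lineP.
Qed.

(** The forms chosen at the various points all have the same kernel by [parallel_hyperplanes], so
    the one at the origin serves everywhere. *)
Lemma fibers_parallel : exists2 u : 'cV[R]_(1 + d), u != 0 &
  forall p v, (forall t : R, phi (p + t *: v) = phi p) <-> (v *m u) 0 0 = 0.
Proof.
have /choice[u uP] : forall p, exists u : 'cV[R]_(1 + d), u != 0 /\
    forall v, (forall t : R, phi (p + t *: v) = phi p) <-> (v *m u) 0 0 = 0.
  by move=> p; have [u ? ?] := constant_on_hyperplane p; exists u.
exists (u 0) => [|p v]; first by have [] := uP 0.
have a_scalar q : scalar (fun v : 'rV[R]_(1 + d) => (v *m u q) 0 0).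
  by move=> k x y; rewrite mulmxDl -scalemxAl !mxE.
have par := parallel_hyperplanes a_scalar (fun q => (uP q).2).
by apply: iff_trans ((uP p).2 v) _; split; exact: par.
Qed.

End Factorization.

Theorem proposition2p5 (R : realType) (d n : nat)
    (N : pseudo_riemannian R n) (hN : riemannian N)
    (phi : minkowski_space R d -> N) (htg : totally_geodesic phi)
    (hrank : forall p : minkowski_space R d, tangent_rank phi p 1) :
  exists (phiS : minkowski_space R d -> real_line R) (phiI : real_line R -> N),
    [/\ totally_geodesic phiS, submersion phiS,
        totally_geodesic phiI, immersion phiI &
        forall p : minkowski_space R d, phi p = phiI (phiS p)].
Proof.
have [u u0 uP] := fibers_parallel htg hN hrank.
(* Rescale a basis vector on which the form [u] does not vanish. *)
have [e eu] : exists e : 'rV[R]_(1 + d), (e *m u) 0 0 = 1.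
  have /cV0Pn[i ui] := u0.
  exists ((u i 0)^-1 *: delta_mx 0 i).
  by rewrite -scalemxAl -rowE !mxE mulVf.
have phiS_tg : totally_geodesic
    ((fun p => (p *m u) 0 0) : minkowski_space R d -> real_line R).
  apply: (affine_totally_geodesic (A := u) (b := 0)) => p /=.
  by rewrite addr0 [RHS]mx11_scalar; apply/rowP => j; rewrite !mxE ord1.
have phiI_tg := totally_geodesic_line htg e.
exists (fun p => (p *m u) 0 0), (fun s => phi (s *: e)); split=> //.
- split; first exact: phiS_tg.1.
  move=> p i j _ _; rewrite (_ : local_rep _ _ _ = mulmxr u).
    by rewrite jacobian_mulmxr rank_cV u0.
  by apply/funext => v; apply/rowP => k; rewrite /local_rep /= mxE ord1.
- split=> [|s i j _ js]; first exact: phiI_tg.1.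
  (* The Jacobian is a single row, so only its vanishing must be excluded. By the chain rule that
     would put [e] in the kernel of the differential of [phi], hence in that of [u], against
     [eu]. *)
  rewrite rank_rV; apply/eqP; rewrite eqb1; apply/eqP => J0.
  have fD : differentiable
      (local_rep ((fun s => phi (s *: e)) : real_line R -> N) i j) (to_row s).
    have [_ /(_ i j 1)[fD _]] := phiI_tg.1; apply: fD; by exists s.
  have fE : local_rep ((fun s => phi (s *: e)) : real_line R -> N) i j =
      (fun v => (chart_map (charts j) \o phi) (mulmxr e v + 0)).
    apply/funext => v; rewrite /local_rep /= addr0; congr (chart_map _ (phi _)).
    by apply/rowP => k; rewrite !mxE big_ord1.
  have eE (r : R) : to_row r *m e = r *: e.
    by apply/rowP => k; rewrite !mxE big_ord1 !mxE.
  have := deriveEjacobian (to_row 1) fD; rewrite J0 mulmx0 fE.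
  have := congr1 (@^~ (to_row s)) (derive_linear_shift (mulmxr e) 0
    (chart_map (charts j) \o phi : 'rV[R]_(1 + d) -> 'rV[R]_n) (to_row 1)).
  rewrite /= !eE scale1r addr0 => ->.
  rewrite deriveEjacobian; last exact: minkowski_rep_differentiable.
  move/(constant_on_lineP htg e hN js)/uP; rewrite eu => /eqP.
  by rewrite oner_eq0.
(* The vector from [phiS p *: e] to [p] is in the kernel of [u], so [phi] is constant on the line
   joining them; time 1 reaches [p]. *)
move=> p; have := (uP ((p *m u) 0 0 *: e) (p - (p *m u) 0 0 *: e)).2 _ 1.
rewrite scale1r addrCA subrr addr0; apply.
rewrite mulmxBl -scalemxAl; move: (p *m u) (e *m u) eu => x y y1.
by rewrite !mxE y1 mulr1 subrr.
Qed.
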